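(* Let $n\ge1$ and $h\ge\mu>0$, and let $\tau(t)=h+\eta(t)$, $t\ge 0$, where $\eta$ is a measurable real function with $|\eta(t)|\le\mu$ for all $t$ (no constraint on the derivative of the delay). Put $\mathcal F(\infty)=7/4$. Then for every $y\in L_2[0,\infty)$, extended by $y(t)=0$ for all $t\le 0$, the function $$u(t)=-\frac{1}{\mu\sqrt{\mathcal F(\infty)}}\int_{-h-\eta(t)}^{-h}y(t+s)\,ds,\qquad t\ge 0,$$ satisfies $$\|u\|_{L_2}^2\le\|y\|_{L_2}^2 .$$
   Context: $L_2=L_2[0,\infty)$ is the space of square integrable functions $v:[0,\infty)\to\mathbb C^n$ with norm $\|v\|_{L_2}=\left[\int_0^\infty\|v(t)\|^2dt\right]^{1/2}$, where $\|\cdot\|$ is the Euclidean norm. The integral $\int_{-h-\eta(t)}^{-h}$ is an oriented integral (its sign changes when $\eta(t)<0$). The constant $h$ is the nominal delay value and $\mu$ is the bound on the delay uncertainty. *)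

(* Defs.v *)
From HB Require Import structures.
From mathcomp Require Import all_boot all_order all_algebra.
From mathcomp Require Import complex.
From mathcomp Require Import all_classical all_reals all_analysis.

Set Implicit Arguments.
Unset Strict Implicit.
Unset Printing Implicit Defensive.

Import Order.TTheory GRing.Theory Num.Theory.

Local Open Scope classical_set_scope.
Local Open Scope ring_scope.
Local Open Scope complex_scope.

(* The library equips a realType R with its Borel sigma-algebra, on which null
   sets need not be measurable; "measurable" below means Lebesgue measurable,
   i.e. relative to this alias of R, the domain of completed_lebesgue_measure. *)
Definition lebesgue_type (R : realType) :=
  caratheodory_type ((@wlength R idfun)^*)%mu.

Definition leb_measurable (R : realType) (D : set R) (f : R -> R) : Prop :=
  measurable_fun (D : set (lebesgue_type R)) (f : lebesgue_type R -> R).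

Definition enorm (R : realType) (n : nat) (v : 'cV[R[i]]_n) : R :=
  Num.sqrt (\sum_(i < n) ComplexField.Normc.normc (v i ord0) ^+ 2).

(* Membership of v in L_2[0, oo); only the values of v on [0, oo) matter. *)
Definition L2 (R : realType) (n : nat) (v : R -> 'cV[R[i]]_n) : Prop :=
  (forall i : 'I_n,
     leb_measurable `[0, +oo[ (fun t => complex.Re (v t i ord0)) /\
     leb_measurable `[0, +oo[ (fun t => complex.Im (v t i ord0))) /\
  (\int[@completed_lebesgue_measure R]_(t in `[0%R, +oo[)
     (enorm (v t) ^+ 2)%:E < +oo)%E.

(* Meaningful for v satisfying L2 only: Rintegral collapses infinite integrals
   to 0. *)
Definition L2norm (R : realType) (n : nat) (v : R -> 'cV[R[i]]_n) : R :=
  Num.sqrt (\int[@completed_lebesgue_measure R]_(t in `[0, +oo[)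
              enorm (v t) ^+ 2).

(* The Lebesgue integral of a C^n-valued function, taken entrywise. *)
Definition vintegral (R : realType) (n : nat) (D : set R)
    (f : R -> 'cV[R[i]]_n) : 'cV[R[i]]_n :=
  \col_(i < n)
    ((\int[@completed_lebesgue_measure R]_(s in D) complex.Re (f s i ord0)) +i*
     (\int[@completed_lebesgue_measure R]_(s in D) complex.Im (f s i ord0))).

Definition oriented_integral (R : realType) (n : nat) (a b : R)
    (f : R -> 'cV[R[i]]_n) : 'cV[R[i]]_n :=
  if a <= b then vintegral `[a, b] f else - vintegral `[b, a] f.

(* The extension of a function on [0, oo) by 0 on ]-oo, 0]; the prescribed
   value at t = 0 is 0. *)
Definition zero_ext (R : realType) (n : nat) (y : R -> 'cV[R[i]]_n) (t : R) :
    'cV[R[i]]_n :=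
  if t <= 0 then 0 else y t.

Definition Finfty (R : realType) : R := 7 / 4.

(* Main.v *)
Require Import Defs.
From HB Require Import structures.
From mathcomp Require Import all_boot all_order all_algebra.
From mathcomp Require Import complex.
From mathcomp Require Import all_classical all_reals all_analysis.
From mathcomp Require Import measurable_realfun.
From mathcomp Require Import ring lra.

(** Applied to |y|, the operator y |-> u is dominated by T, where T f (t) is the
    integral of f over a window W_t of length mu lying on one side of t - h;
    the side is the sign of eta t.  The kernel of T T^* is the overlap
    K(t, t') = |W_t /\ W_t'|, so Schur's test gives |T|^2 = |T T^*| <=
    sup_t \int K(t, t') dt'.  If W_t lies to the right of t - h, then, with
    d = t' - t, whatever the side chosen at t', K(t, t') is at most mu + d on
    [-mu, 0], max(d, mu - d) on [0, mu], 2 mu - d on [mu, 2 mu] and 0 elsewhere;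
    this majorant has integral 7/4 mu^2.  The left-sided case is its mirror
    image.  A plain Cauchy-Schwarz bound would only give 2 mu^2.  Since this
    works for scalar functions, C^n-valued ones are treated through their 2n
    real coordinates. *)

Set Implicit Arguments.
Unset Strict Implicit.
Unset Printing Implicit Defensive.

Import Order.TTheory GRing.Theory Num.Theory.
Import numFieldNormedType.Exports.

Local Open Scope classical_set_scope.
Local Open Scope ring_scope.
Local Open Scope complex_scope.

(** * Integral inequalities *)

(** For finite values this is the expansion of (c x - y)^2 >= 0. If [x] or [y] is [+oo], the
    right-hand side is [+oo], because c^2 > 0. *)
Lemma mule_weighted_AMGM (R : realType) (c : R) (x y : \bar R) : 0 < c ->
  (0 <= x -> 0 <= y ->
   (2 * c)%:E * (x * y) <= (c ^+ 2)%:E * (x * x) + y * y)%E.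
Proof.
move=> c0; have c20 : 0 < c ^+ 2 by rewrite exprn_gt0.
have c2y : ((c ^+ 2)%:E * +oo = +oo)%E by rewrite gt0_muley ?lte_fin.
case: x => [x| |] // x0; case: y => [y| |] // y0.
- by rewrite -!EFinM -EFinD lee_fin; have := sqr_ge0 (c * x - y); lra.
- by rewrite mulyy addey ?leey// -!EFinM.
- by rewrite mulyy c2y addye ?leey// -EFinM.
- by rewrite !mulyy c2y addye ?leey.
Qed.

Lemma integral_AMGM d (T : measurableType d) (R : realType)
    (m : {measure set T -> \bar R}) (w f g : T -> \bar R) :
  measurable_fun setT w -> measurable_fun setT f -> measurable_fun setT g ->
  (forall x, 0 <= w x)%E -> (forall x, 0 <= f x)%E -> (forall x, 0 <= g x)%E ->
  (2%:E * \int[m]_x (w x * (f x * g x)) <=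
   \int[m]_x (w x * (f x * f x)) + \int[m]_x (w x * (g x * g x)))%E.
Proof.
move=> mw mf mg w0 f0 g0.
have mwM (p q : T -> \bar R) : measurable_fun setT p -> measurable_fun setT q ->
    measurable_fun setT (fun x => w x * (p x * q x))%E.
  by move=> mp mq; apply: emeasurable_funM => //; exact: emeasurable_funM.
have wM0 (p q : T -> \bar R) : (forall x, 0 <= p x)%E ->
    (forall x, 0 <= q x)%E -> forall x, (0 <= w x * (p x * q x))%E.
  by move=> p0 q0 x; rewrite !mule_ge0.
rewrite -ge0_integralD//; [|by move=> *; apply: wM0|exact: mwM|
  by move=> *; apply: wM0|exact: mwM].
rewrite -ge0_integralZl//; [|exact: mwM|by move=> *; apply: wM0].
apply: ge0_le_integral => //.
- by move=> x _; rewrite mule_ge0// wM0.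
- by apply: measurable_funeM; exact: mwM.
- by apply: emeasurable_funD; exact: mwM.
- move=> x _; rewrite muleCA -ge0_muleDr ?mule_ge0//.
  by rewrite lee_wpmul2l//; have := @mule_weighted_AMGM R 1 (f x) (g x);
    rewrite mulr1 expr1n mul1e; exact.
Qed.

(** This plays the role of Cauchy-Schwarz. Integrating the weighted inequality with weight [C] gives
    2 C a <= C^2 \int f^2 + \int h^2 <= C^2 \int f^2 + C a. Since [a] is finite, C a can be
    cancelled, and dividing by [C] gives the claim. *)
Lemma dual_integral_le d (T : measurableType d) (R : realType)
    (m : {measure set T -> \bar R}) (f h : T -> \bar R) (a : \bar R) (C : R) :
  measurable_fun setT f -> measurable_fun setT h ->
  (forall x, 0 <= f x)%E -> (forall x, 0 <= h x)%E -> 0 < C ->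
  a \is a fin_num -> (a = \int[m]_x (f x * h x))%E ->
  (\int[m]_x (h x * h x) <= C%:E * a)%E ->
  (a <= C%:E * \int[m]_x (f x * f x))%E.
Proof.
move=> mf mh f0 h0 C0 afin aE hle.
have mff : measurable_fun setT (fun x => f x * f x)%E by exact: emeasurable_funM.
have mhh : measurable_fun setT (fun x => h x * h x)%E by exact: emeasurable_funM.
have mfh : measurable_fun setT (fun x => f x * h x)%E by exact: emeasurable_funM.
have ff0 : (0 <= \int[m]_x (f x * f x))%E.
  by apply: integral_ge0 => x _; rewrite mule_ge0.
have : ((2 * C)%:E * a <=
       (C ^+ 2)%:E * (\int[m]_x (f x * f x)) + C%:E * a)%E.
  apply: (le_trans _ (leeD2l _ hle)).
  rewrite aE -!ge0_integralZl//; last 4 first.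
  - by move=> x _; rewrite mule_ge0.
  - by rewrite lee_fin sqr_ge0.
  - by move=> x _; rewrite mule_ge0.
  - by rewrite lee_fin mulr_ge0// ltW.
  rewrite -ge0_integralD//; last 3 first.
  - by move=> x _; rewrite !mule_ge0// lee_fin sqr_ge0.
  - exact: measurable_funeM.
  - by move=> x _; rewrite mule_ge0.
  apply: ge0_le_integral => //.
  - by move=> x _; rewrite !mule_ge0// lee_fin mulr_ge0// ltW.
  - exact: measurable_funeM.
  - by apply: emeasurable_funD => //; exact: measurable_funeM.
  - by move=> x _; exact: mule_weighted_AMGM.
rewrite -(fineK afin); move: ff0; case: (integral m _ _) => [b| |] // _.
  rewrite -!EFinM -EFinD !lee_fin => le.
  by rewrite -(ler_pM2l C0); lra.
by move=> _; rewrite gt0_muley ?lte_fin// leey.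
Qed.

(** * Schur's test applied to T T^*, where T has kernel [k] *)

Section Schur.
Context d1 d2 (T1 : measurableType d1) (T2 : measurableType d2) (R : realType).
Variables (m1 : {sigma_finite_measure set T1 -> \bar R}).
Variables (m2 : {sigma_finite_measure set T2 -> \bar R}).
Variables (k : T1 * T2 -> \bar R) (f : T2 -> \bar R) (C : R).
Local Open Scope ereal_scope.
Hypotheses (mk : measurable_fun setT k) (k0 : forall x, 0 <= k x).
Hypotheses (mf : measurable_fun setT f) (f0 : forall x, 0 <= f x).
Hypothesis C0 : (0 < C)%R.

(** Kernel of T T^*. Below, [G] is T f and [H] is T^* G, that is T^* T f. *)
Let K (p : T1 * T1) := \int[m2]_s (k (p.1, s) * k (p.2, s)).
Hypothesis hK : forall t, \int[m1]_t' K (t, t') <= C%:E.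

Let G t := \int[m2]_s (k (t, s) * f s).

Let mG : measurable_fun setT G.
Proof.
apply: (@measurable_fun_fubini_tonelli_F _ _ T1 T2 R m2
  (fun z => k z * f z.2)).
- by apply: emeasurable_funM => //; exact: measurableT_comp.
- by move=> z; rewrite mule_ge0.
Qed.

Let G0 t : 0 <= G t. Proof. by apply: integral_ge0 => s _; rewrite mule_ge0. Qed.

Let H s := \int[m1]_t (k (t, s) * G t).

Let mH : measurable_fun setT H.
Proof.
apply: (@measurable_fun_fubini_tonelli_G _ _ T1 T2 R m1
  (fun z => k z * G z.1)).
- by apply: emeasurable_funM => //; exact: measurableT_comp.
- by move=> z; rewrite mule_ge0.
Qed.

Let H0 t : 0 <= H t. Proof. by apply: integral_ge0 => s _; rewrite mule_ge0. Qed.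

Let mkt t : measurable_fun setT (fun s => k (t, s)).
Proof. by apply: measurableT_comp => //; exact: measurable_pair1. Qed.

Let mks s : measurable_fun setT (fun t => k (t, s)).
Proof. by apply: measurableT_comp => //; exact: measurable_pair2. Qed.

Let mK : measurable_fun setT K.
Proof.
apply: (@measurable_fun_fubini_tonelli_F _ _ (T1 * T1)%type T2 R m2
  (fun z => k (z.1.1, z.2) * k (z.1.2, z.2))).
- apply: emeasurable_funM; apply: measurableT_comp => //;
  by apply: measurable_fun_pair => //; do 2! apply: measurableT_comp => //.
- by move=> z; rewrite mule_ge0.
Qed.

Let K0 p : 0 <= K p. Proof. by apply: integral_ge0 => s _; rewrite mule_ge0. Qed.

(** The adjoint identity <T f, G> = <f, T^* G>, by Tonelli; every integrand is nonnegative, so no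
    integrability is at stake. *)
Let GG : \int[m1]_t (G t * G t) = \int[m2]_s (f s * H s).
Proof.
transitivity (\int[m1]_t \int[m2]_s (k (t, s) * f s * G t)).
  apply: eq_integral => t _; rewrite ge0_integralZr//.
  - by apply: emeasurable_funM => //; exact: measurableT_comp.
  - by move=> s _; rewrite mule_ge0.
rewrite (fubini_tonelli (fun z => k z * f z.2 * G z.1)); last 2 first.
- apply: emeasurable_funM; last exact: measurableT_comp.
  by apply: emeasurable_funM => //; exact: measurableT_comp.
- by move=> z; rewrite !mule_ge0.
apply: eq_integral => s _ /=; rewrite -ge0_integralZl//.
- by apply: eq_integral => t _; rewrite muleA (muleC (f s)).
- by apply: emeasurable_funM.
- by move=> t _; rewrite mule_ge0.
Qed.

(** This is |T^* G|^2 = <T T^* G, G>. One factor [H s] is expanded and [s] exchanged with [t]; then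
    the other is expanded and, for fixed [t], [s] is exchanged with [t']. *)
Let HH : \int[m2]_s (H s * H s) = \int[m1]_t \int[m1]_t' (K (t, t') * (G t * G t')).
Proof.
transitivity (\int[m2]_s \int[m1]_t (k (t, s) * G t * H s)).
  apply: eq_integral => s _; rewrite ge0_integralZr//.
  - exact: emeasurable_funM.
  - by move=> t _; rewrite mule_ge0.
rewrite -(fubini_tonelli (fun z => k z * G z.1 * H z.2)); last 2 first.
- apply: emeasurable_funM; last exact: measurableT_comp.
  by apply: emeasurable_funM => //; exact: measurableT_comp.
- by move=> z; rewrite !mule_ge0.
apply: eq_integral => t _ /=.
transitivity (\int[m2]_s \int[m1]_t' (k (t, s) * G t * (k (t', s) * G t'))).
  apply: eq_integral => s _; rewrite ge0_integralZl//.
  - exact: emeasurable_funM.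
  - by move=> t' _; rewrite mule_ge0.
  - by rewrite mule_ge0.
rewrite -(fubini_tonelli (fun z => k (t, z.2) * G t * (k z * G z.1))); last 2 first.
- apply: emeasurable_funM.
    by apply: emeasurable_funM => //; exact: (measurableT_comp (mkt t)).
  by apply: emeasurable_funM => //; exact: measurableT_comp.
- by move=> z; rewrite !mule_ge0.
apply: eq_integral => t' _ /=.
rewrite /K -ge0_integralZr//=.
- by apply: eq_integral => s _; rewrite muleACA.
- exact: emeasurable_funM.
- by move=> s _; rewrite mule_ge0.
- by rewrite mule_ge0.
Qed.

Let mKGG (p q : T1 * T1 -> T1) : measurable_fun setT p ->
  measurable_fun setT q ->
  measurable_fun setT (fun z : T1 * T1 => K z * (G (p z) * G (q z))).
Proof.
by move=> mp mq; apply: emeasurable_funM => //; apply: emeasurable_funM;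
  exact: measurableT_comp.
Qed.

Let KGG0 (p q : T1 * T1 -> T1) z : 0 <= K z * (G (p z) * G (q z)).
Proof. by rewrite !mule_ge0. Qed.

(** The second variable is integrated first: it occurs only in [K], so [hK] bounds the inner
    integral by [C]. *)
Let KGG11 : \int[m1 \x m1]_z (K z * (G z.1 * G z.1)) <=
  C%:E * \int[m1]_t (G t * G t).
Proof.
rewrite (fubini_tonelli1 _ (mKGG measurable_fst measurable_fst) (KGG0 _ _)).
rewrite -ge0_integralZl//; last 3 first.
- exact: emeasurable_funM.
- by move=> t _; rewrite mule_ge0.
- by rewrite lee_fin ltW.
apply: ge0_le_integral => //.
- by move=> t _; apply: integral_ge0 => t' _; rewrite !mule_ge0.
- apply: (measurable_fun_fubini_tonelli_F _
    (mKGG measurable_fst measurable_fst)) => z; exact: KGG0.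
- by apply: measurable_funeM; exact: emeasurable_funM.
- move=> t _; rewrite /fubini_F/= ge0_integralZr//.
  + by rewrite lee_wpmul2r ?mule_ge0.
  + by apply: measurableT_comp => //; exact: measurable_pair1.
  + by rewrite mule_ge0.
Qed.

Let KGG22 : \int[m1 \x m1]_z (K z * (G z.2 * G z.2)) =
  \int[m1 \x m1]_z (K z * (G z.1 * G z.1)).
Proof.
apply: (etrans (fubini_tonelli2 _ (mKGG measurable_snd measurable_snd)
  (KGG0 _ _))).
apply/esym/(etrans (fubini_tonelli1 _ (mKGG measurable_fst measurable_fst)
  (KGG0 _ _)))/esym.
apply: eq_integral => t _; apply: eq_integral => t' _; congr (_ * _).
by apply: eq_integral => s _; rewrite muleC.
Qed.

(** Schur's argument: 2 G(t) G(t') <= G(t)^2 + G(t')^2 under the weight [K]. Each square contributes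
    at most C |G|^2, the second one by the symmetry of [K]; both sides are doubled to absorb the
    factor 2. *)
Let HHle : \int[m2]_s (H s * H s) <= C%:E * \int[m1]_t (G t * G t).
Proof.
rewrite HH -(fubini_tonelli1 _ (mKGG measurable_fst measurable_snd) (KGG0 _ _)).
rewrite -(@lee_pmul2l _ 2%:E erefl (lte0n 2)).
have mGp (p : T1 * T1 -> T1) : measurable_fun setT p ->
    measurable_fun setT (G \o p) by exact: measurableT_comp.
have Gp0 (p : T1 * T1 -> T1) z : 0 <= (G \o p) z by exact: G0.
apply: (le_trans (integral_AMGM (m1 \x m1) mK (mGp _ measurable_fst)
  (mGp _ measurable_snd) K0 (Gp0 _) (Gp0 _))).
have twice (x : \bar R) : x + x = 2%:E * x by rewrite mule_natl mule2n.
rewrite -[leRHS]twice; apply: leeD; first exact: KGG11.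
rewrite KGG22; exact: KGG11.
Qed.

(** Here |G|^2 = <f, H> and |H|^2 <= C |G|^2, so the duality inequality applies with a = |G|^2.
    Finiteness of |G|^2 is assumed because that inequality cancels it. *)
Lemma Schur_TTstar : \int[m1]_t (G t * G t) < +oo ->
  \int[m1]_t (G t * G t) <= C%:E * \int[m2]_s (f s * f s).
Proof.
move=> Goo; apply: (dual_integral_le mf mH f0 H0 C0 _ GG HHle).
rewrite (ge0_fin_numE (integral_ge0 _ _)); first exact: Goo.
by move=> t _; rewrite mule_ge0.
Qed.

End Schur.

(** Cauchy-Schwarz against a constant. With I the integral of [f] over [D], the duality inequality
    is used for h = I on [D] and 0 elsewhere: then a = I^2, and \int h^2 = I^2 m(D) <= c I^2. *)
Lemma sqr_integral_le d (T : measurableType d) (R : realType)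
    (m : {measure set T -> \bar R}) (D : set T) (f : T -> \bar R) (c : R) :
  measurable D -> measurable_fun setT f -> (forall x, 0 <= f x)%E ->
  0 < c -> (m D <= c%:E)%E ->
  ((\int[m]_(x in D) f x) * (\int[m]_(x in D) f x) <=
   c%:E * \int[m]_(x in D) (f x * f x))%E.
Proof.
move=> mD mf f0 c0 mDc.
have mff : measurable_fun setT (fun x => f x * f x)%E by exact: emeasurable_funM.
have I0 : (0 <= \int[m]_(x in D) f x)%E by apply: integral_ge0.
have J0 : (0 <= \int[m]_(x in D) (f x * f x))%E.
  by apply: integral_ge0 => x _; rewrite mule_ge0.
have [->|Jfin] := eqVneq (\int[m]_(x in D) (f x * f x))%E +oo%E.
  by rewrite gt0_muley ?lte_fin// leey.
(* I is finite because f <= 1 + f^2 and [D] has finite measure. *)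
have Ioo : (\int[m]_(x in D) f x < +oo)%E.
  apply: (@le_lt_trans _ _ (\int[m]_(x in D) (1 + f x * f x))%E).
    apply: ge0_le_integral => //.
    - exact: measurable_funTS.
    - by apply: measurable_funTS; apply: emeasurable_funD.
    - move=> x _; have := f0 x; case: (f x) => [r| |] //.
        rewrite lee_fin => r0; rewrite -EFinM -EFinD lee_fin.
        by have := sqr_ge0 (r - 1); have := sqr_ge0 r; lra.
  rewrite ge0_integralD//; last 2 first.
  - by move=> x _; rewrite mule_ge0.
  - exact: measurable_funTS.
  rewrite integral_cst// mul1e lte_add_pinfty//.
    by rewrite (le_lt_trans mDc)// ltry.
  by rewrite lt_neqAle Jfin leey.
have Ifin : (\int[m]_(x in D) f x)%E \is a fin_num by rewrite ge0_fin_numE.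
set I := (\int[m]_(x in D) f x)%E in I0 Ifin *.
have fE x : ((f \_ D) x * (f \_ D) x = ((fun x => f x * f x) \_ D) x)%E.
  by rewrite /patch; case: ifP => // _; rewrite mule0.
have fhE x : ((f \_ D) x * (cst I \_ D) x = ((fun x => f x * I) \_ D) x)%E.
  by rewrite /patch; case: ifP => // _; rewrite mule0.
have hE x : ((cst I \_ D) x * (cst I \_ D) x = (cst (I * I) \_ D) x)%E.
  by rewrite /patch; case: ifP => // _; rewrite mule0.
rewrite [X in (_ <= _ * X)%E]integral_mkcond.
under [X in (_ <= _ * X)%E]eq_integral do rewrite -fE.
apply: (@dual_integral_le _ _ _ _ _ (cst I \_ D)) => //.
- by apply/(measurable_restrictT _ _).1 => //; exact: measurable_funTS.
- by apply/(measurable_restrictT _ _).1.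
- by move=> x; apply: erestrict_ge0.
- by move=> x; apply: erestrict_ge0.
- exact: fin_numM.
- under eq_integral do rewrite fhE.
  rewrite -integral_mkcond ge0_integralZr//.
  exact: measurable_funTS.
- under eq_integral do rewrite hE.
  rewrite -integral_mkcond integral_cst// muleC.
  by rewrite lee_wpmul2r// mule_ge0.
Qed.

Lemma ge0_le_integralT d (T : measurableType d) (R : realType)
    (m : {measure set T -> \bar R}) (f g : T -> \bar R) :
  measurable_fun setT f -> measurable_fun setT g -> (forall x, 0 <= f x)%E ->
  (forall x, f x <= g x)%E -> (\int[m]_x f x <= \int[m]_x g x)%E.
Proof. by move=> mf mg f0 fg; apply: ge0_le_integral. Qed.

(** * The completed Lebesgue measure *)

Section LebesgueMeasure.
Variable R : realType.
Local Notation L := (lebesgue_type R).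
Local Notation lam := (@completed_lebesgue_measure R).

Lemma measurable_lebesgue_type (A : set R) : measurable A ->
  measurable (A : set L).
Proof. exact: sub_caratheodory. Qed.

Lemma measurable_id_lebesgue_type :
  measurable_fun [set: L] (id : L -> measurableTypeR R).
Proof. by move=> _ A mA; rewrite setTI; exact: measurable_lebesgue_type. Qed.

(* [measurableTypeR R] and [R] carry the same sigma-algebra under different
   displays. *)
Lemma measurable_lebesgue_typeR : measurable_fun [set: L] (id : L -> R).
Proof. exact: measurable_id_lebesgue_type. Qed.

Lemma completed_lebesgue_measure_itv (a b : R) : a <= b ->
  lam `[a, b] = (b - a)%:E.
Proof.
move=> ab; transitivity (@lebesgue_measure R `[a, b]) => //.
rewrite lebesgue_measure_itv/= lte_fin; case: ltP => // ba.
by rewrite (@le_anti _ _ a b) ?ab ?ba// subrr.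
Qed.

(** On Borel sets the two measures agree, so [lebesgue_measure] is the pushforward of the completed
    measure by the identity. This gives access to the fundamental theorem of calculus. *)
Lemma ge0_integral_completed (D : set (measurableTypeR R))
    (f : measurableTypeR R -> \bar R) : measurable D ->
  measurable_fun D f -> (forall x, D x -> 0 <= f x)%E ->
  (\int[lam]_(x in D) f x = \int[lebesgue_measure]_(x in D) f x)%E.
Proof.
move=> mD mf f0; apply/esym.
transitivity (\int[pushforward lam (id : L -> measurableTypeR R)]_(x in D) f x)%E.
  apply: eq_measure_integral => [|mid A mA AD]; first exact: measurable_id_lebesgue_type.
  exact: erefl.
rewrite (ge0_integral_pushforward measurable_id_lebesgue_type)//.
by move=> x /[!inE]; exact: f0.
Qed.

(** A translation maps covers by half-open intervals to such covers of the same total length. This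
    gives one inequality for every shift; the inverse shift gives the other. *)
Lemma mu_ext_shift (c : R) (A : set R) :
  mu_ext (@wlength R idfun) (+%R c @^-1` A) = mu_ext (@wlength R idfun) A.
Proof.
suff le d B : (mu_ext (@wlength R idfun) (+%R d @^-1` B) <=
               mu_ext (@wlength R idfun) B)%E.
  apply/eqP; rewrite eq_le le/=.
  rewrite [X in mu_ext _ X](_ : A = +%R (- c) @^-1` (+%R c @^-1` A)) ?le//.
  by apply/funext => x /=; rewrite addNKr.
apply: le_ereal_inf => _ [F [mF BF] <-].
have shiftF k : exists2 x : R * R, F k = `]x.1, x.2]%classic &
    +%R d @^-1` F k = `]x.1 - d, x.2 - d]%classic.
  have [x _ xF] := mF k; exists x => //; rewrite -xF.
  by apply/seteqP; split=> y /=; rewrite !in_itv/= ltrBlDl lerBrDl.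
exists (fun k => +%R d @^-1` F k).
  split; last by move=> x /BF[k _ Fk]; exists k.
  by move=> k; have [x _ ->] := shiftF k; exact: is_ocitv.
apply: eq_eseriesr => k _; have [x -> ->] := shiftF k.
rewrite !wlength_itv/= !lte_fin ltrD2r; case: ifP => // _.
by rewrite -!EFinB; congr (_%:E); lra.
Qed.

(** The Caratheodory criterion for the preimage of [A], tested on [X], is the criterion for [A]
    tested on a translate of [X], since the outer measure is translation invariant. *)
Lemma measurable_shift_lebesgue_type (c : R) :
  measurable_fun [set: L] (+%R c : L -> L).
Proof.
move=> _ A mA; rewrite setTI.
suff : (@wlength R idfun)^*%mu.-caratheodory (+%R c @^-1` A) by exact.
have {}mA : (@wlength R idfun)^*%mu.-caratheodory A by exact: mA.
move=> X; rewrite -(mu_ext_shift (- c) X) (mA (+%R (- c) @^-1` X)).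
rewrite -(mu_ext_shift c (_ `&` A)) -(mu_ext_shift c (_ `&` ~` A)).
have preE B : +%R c @^-1` (+%R (- c) @^-1` X `&` B) = X `&` (+%R c @^-1` B).
  by apply/funext => x /=; rewrite /setI/= addKr.
by rewrite !preE.
Qed.

Lemma ge0_integral_shift (c : R) (D : set L) (f : L -> \bar R) :
  measurable D -> measurable_fun D f -> (forall x, 0 <= f x)%E ->
  (\int[lam]_(s in D) f s =
   \int[lam]_(s in (+%R c : L -> L) @^-1` D) f (c + s)%R)%E.
Proof.
move=> mD mf f0.
rewrite -(ge0_integral_pushforward (measurable_shift_lebesgue_type c))//.
apply: eq_measure_integral => [|mc A mA AD].
  exact: measurable_shift_lebesgue_type.
exact: (esym (mu_ext_shift c A)).
Qed.

Lemma integral_shift (c : R) (D : set L) (f : L -> \bar R) :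
  measurable D -> measurable_fun D f ->
  (\int[lam]_(s in D) f s =
   \int[lam]_(s in (+%R c : L -> L) @^-1` D) f (c + s)%R)%E.
Proof.
move=> mD mf; rewrite integralE [RHS]integralE.
rewrite (ge0_integral_shift c mD (measurable_funepos mf)); last first.
  exact: funepos_ge0.
rewrite (ge0_integral_shift c mD (measurable_funeneg mf)); last first.
  exact: funeneg_ge0.
by congr (_ - _)%E; apply: eq_integral => s _; rewrite ?funeposE ?funenegE.
Qed.

End LebesgueMeasure.

(** * Integrals bounded by piecewise affine majorants *)

Section AffineMajorant.
Variable R : realType.
Local Notation L := (lebesgue_type R).
Local Notation lam := (@completed_lebesgue_measure R).

Lemma integral_affine (a b p q : R) : a < b ->
  (forall x, a <= x <= b -> 0 <= p * x + q) ->
  (\int[lam]_(x in `[a, b]) (p * x + q)%:E =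
   (p * (b ^+ 2 - a ^+ 2) / 2 + q * (b - a))%:E)%E.
Proof.
move=> ab f0.
pose f (x : R) := p * x + q.
have cf : continuous f.
  by move=> x; apply: cvgD; [apply: cvgM; [exact: cvg_cst|exact: cvg_id]|
    exact: cvg_cst].
rewrite ge0_integral_completed//; last first.
  apply: measurable_funTS.
  suff : measurable_fun setT (EFin \o (f : measurableTypeR R -> R)) by [].
  by apply/measurable_EFinP; exact: continuous_measurable_fun.
pose F (x : R) := p / 2 * x ^+ 2 + q * x.
have dF (x : R) : is_derive x 1 F (f x).
  by rewrite /F /f; apply: is_derive_eq; rewrite /GRing.scale/=; field.
have cF : continuous F.
  by move=> x; apply/differentiable_continuous/derivable1_diffP.
rewrite (@continuous_FTC2 _ f F)//.
- by rewrite -EFinB /F; congr (_%:E); field.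
- exact: continuous_subspaceT.
- split; first by move=> x _.
  + by apply: cvg_at_right_filter; exact: cF.
  + by apply: cvg_at_left_filter; exact: cF.
- by move=> x _; rewrite derive1E; apply: derive_val.
Qed.

Lemma integral_le_affine (w : L -> \bar R) (a b p q : R) :
  measurable_fun [set: L] w -> (forall x, 0 <= w x)%E -> a < b ->
  (forall x, a <= x <= b -> (w x <= (p * x + q)%:E)%E) ->
  (\int[lam]_(x in `[a, b]) w x <=
   (p * (b ^+ 2 - a ^+ 2) / 2 + q * (b - a))%:E)%E.
Proof.
move=> mw w0 ab wle; rewrite -integral_affine//; last first.
  by move=> x /wle; rewrite -lee_fin; exact: le_trans.
have wle' x : (`[a, b]%classic : set L) x -> (w x <= (p * x + q)%:E)%E.
  by rewrite /= in_itv/=; exact: wle.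
apply: ge0_le_integral; [|by move=> x _; exact: w0| | |exact: wle'].
- exact: measurable_lebesgue_type.
- exact: measurable_funTS.
- apply: measurable_funTS; apply/measurable_EFinP.
  apply: (@measurableT_comp _ _ _ _ _ _ (fun x : R => p * x + q)
    _ (id : L -> R)).
    apply: continuous_measurable_fun => x.
    by apply: cvgD; [apply: cvgM; [exact: cvg_cst|exact: cvg_id]|
      exact: cvg_cst].
  exact: measurable_id_lebesgue_type.
Qed.

(** [[a, c]] is covered by the disjoint sets [[a, b]] and []b, c]], whatever the order of the three
    points; closing the second interval can only increase the integral. *)
Lemma integral_split_le (w : L -> \bar R) (a b c : R) :
  measurable_fun [set: L] w -> (forall x, 0 <= w x)%E ->
  (\int[lam]_(x in `[a, c]) w x <=
   \int[lam]_(x in `[a, b]) w x + \int[lam]_(x in `[b, c]) w x)%E.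
Proof.
move=> mw w0.
have mitv (x y : itv_bound R) : measurable ([set` Interval x y] : set L).
  exact: measurable_lebesgue_type.
apply: (@le_trans _ _ (\int[lam]_(x in `[a, b] `|` `]b, c]) w x)%E).
  apply: ge0_subset_integral => //.
  - exact: measurableU.
  - exact: measurable_funTS.
  - move=> x /=; rewrite !in_itv/= => /andP[ax xc].
    by case: (leP x b) => xb; [left|right]; apply/andP.
rewrite ge0_integral_setU//.
- rewrite leeD2l//; apply: ge0_subset_integral => //.
  + exact: measurable_funTS.
  + by move=> x /=; rewrite !in_itv/= => /andP[/ltW -> ->].
- exact: measurable_funTS.
- rewrite disj_set2E; apply/eqP/seteqP; split=> x //=.
  by rewrite !in_itv/= => -[/andP[_ xb] /andP[]]; rewrite ltNge xb.
Qed.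

Lemma integral_support_itv (w : L -> \bar R) (a b : R) :
  (forall x, ~~ (a <= x <= b) -> w x = 0%E) ->
  (\int[lam]_x w x = \int[lam]_(x in `[a, b]) w x)%E.
Proof.
move=> w0; rewrite [RHS]integral_mkcond; apply: eq_integral => x _.
rewrite /patch; case: ifPn => //; rewrite notin_setE/= in_itv/= => /negP.
exact: w0.
Qed.

(** Four pieces match the majorant of the overlap, whose maximum of two affine functions counts for
    two. The final equation isolates the numerical evaluation. *)
Lemma integral_le_affine4 (w : L -> \bar R) (r : R)
    (x0 x1 x2 x3 x4 p1 q1 p2 q2 p3 q3 p4 q4 : R) :
  measurable_fun [set: L] w -> (forall x, 0 <= w x)%E ->
  x0 < x1 -> x1 < x2 -> x2 < x3 -> x3 < x4 ->
  (forall x, ~~ (x0 <= x <= x4) -> w x = 0%E) ->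
  (forall x, x0 <= x <= x1 -> (w x <= (p1 * x + q1)%:E)%E) ->
  (forall x, x1 <= x <= x2 -> (w x <= (p2 * x + q2)%:E)%E) ->
  (forall x, x2 <= x <= x3 -> (w x <= (p3 * x + q3)%:E)%E) ->
  (forall x, x3 <= x <= x4 -> (w x <= (p4 * x + q4)%:E)%E) ->
  (p1 * (x1 ^+ 2 - x0 ^+ 2) / 2 + q1 * (x1 - x0)) +
  ((p2 * (x2 ^+ 2 - x1 ^+ 2) / 2 + q2 * (x2 - x1)) +
  ((p3 * (x3 ^+ 2 - x2 ^+ 2) / 2 + q3 * (x3 - x2)) +
   (p4 * (x4 ^+ 2 - x3 ^+ 2) / 2 + q4 * (x4 - x3)))) = r ->
  (\int[lam]_x w x <= r%:E)%E.
Proof.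
move=> mw w0 x01 x12 x23 x34 wout w1 w2 w3 w4 <-.
rewrite (integral_support_itv wout) [X in (_ <= X)%E]EFinD.
apply: (le_trans (integral_split_le x0 x1 x4 mw w0)).
apply: leeD; first exact: integral_le_affine.
rewrite EFinD; apply: (le_trans (integral_split_le x1 x2 x4 mw w0)).
apply: leeD; first exact: integral_le_affine.
rewrite EFinD; apply: (le_trans (integral_split_le x2 x3 x4 mw w0)).
by apply: leeD; exact: integral_le_affine.
Qed.

End AffineMajorant.

(** * One-sided moving windows *)

Section Window.
Variable R : realType.
Local Notation L := (lebesgue_type R).
Local Notation lam := (@completed_lebesgue_measure R).
Variables (h mu : R) (A : set L).
Hypotheses (mu0 : 0 < mu) (mA : measurable A).

(** [A] is the set of times whose window lies to the left of t - h. Stating membership through s - t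
    makes joint measurability in (t, s) direct. *)
Definition window (t : L) : set L :=
  [set s : L | (A t /\ - h - mu <= (s : R) - (t : R) <= - h) \/
               (~ A t /\ - h <= (s : R) - (t : R) <= - h + mu)].

Definition window_kernel (z : L * L) : \bar R := (\1_(window z.1) z.2)%:E.

Lemma windowE t : window t =
  if `[< A t >] then `[t - h - mu, t - h]%classic else `[t - h, t - h + mu]%classic.
Proof.
apply/seteqP; case: ifPn => /asboolP At; split => s /=; rewrite in_itv/=.
- by move=> [[_ st]|[]//]; lra.
- by move=> st; left; split => //; lra.
- by move=> [[]//|[_ st]]; lra.
- by move=> st; right; split => //; lra.
Qed.

Lemma measurable_window t : measurable (window t).
Proof.
by rewrite windowE; case: ifP => _; exact: measurable_lebesgue_type.
Qed.

Lemma measurable_window_kernel : measurable_fun setT window_kernel.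
Proof.
pose S : set (L * L) := [set z | window z.1 z.2].
rewrite (_ : window_kernel = EFin \o \1_S); last first.
  by apply/funext => z; rewrite /window_kernel /= !indicE; congr (_ %:R%:E);
    apply/idP/idP; rewrite !inE.
apply/measurable_EFinP/measurable_indic.
pose D : L * L -> R := fun z => (z.2 : R) - (z.1 : R).
have mD : measurable_fun setT D.
  apply: (@measurable_funB _ _ _ _ (id \o snd : L * L -> R) (id \o fst)).
    exact: (measurableT_comp (@measurable_lebesgue_typeR R) measurable_snd).
  exact: (measurableT_comp (@measurable_lebesgue_typeR R) measurable_fst).
rewrite (_ : S = (fst @^-1` A `&` D @^-1` `[- h - mu, - h]) `|`
                 (fst @^-1` (~` A) `&` D @^-1` `[- h, - h + mu])); last first.
  by apply/seteqP; split => z /=; rewrite !in_itv.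
have mpre (B : set L) : measurable B -> measurable ((fst : L * L -> L) @^-1` B).
  by move=> mB; rewrite -[X in measurable X]setTI; exact: measurable_fst.
apply: measurableU; apply: measurableI.
- exact: mpre.
- by rewrite -[X in measurable X]setTI; exact: mD.
- by apply: mpre; exact: measurableC.
- by rewrite -[X in measurable X]setTI; exact: mD.
Qed.

Lemma window_kernel_ge0 z : (0 <= window_kernel z)%E.
Proof. by rewrite /window_kernel lee_fin. Qed.

Lemma integral_window_kernel (f : L -> \bar R) t :
  (\int[lam]_s (window_kernel (t, s) * f s) = \int[lam]_(s in window t) f s)%E.
Proof.
rewrite [RHS]integral_mkcond; apply: eq_integral => s _.
rewrite /window_kernel /patch indicE /=; case: ifPn => _; first by rewrite mul1e.
by rewrite mul0e.
Qed.

Let K (t t' : L) := (\int[lam]_s (window_kernel (t, s) * window_kernel (t', s)))%E.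

Lemma overlapE t t' : K t t' = lam (window t `&` window t').
Proof.
rewrite /K integral_window_kernel.
under eq_integral do rewrite /window_kernel/=.
rewrite integral_indic; [by rewrite setIC| |]; exact: measurable_window.
Qed.

Lemma measurable_overlap t : measurable_fun setT (K t).
Proof.
apply: (@measurable_fun_fubini_tonelli_F _ _ L L R lam
  (fun z => window_kernel (t, z.2) * window_kernel z)%E).
  apply: emeasurable_funM; last exact: measurable_window_kernel.
  apply: (measurableT_comp measurable_window_kernel).
  by apply: measurable_fun_pair.
by move=> z; rewrite mule_ge0 ?window_kernel_ge0.
Qed.

Lemma overlap_ge0 t t' : (0 <= K t t')%E.
Proof. by apply: integral_ge0 => s _; rewrite mule_ge0 ?window_kernel_ge0. Qed.

(** The intersection lies in each of [[a, b]], [[c, b]], [[a, d]] and [[c, d]], so any one of the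
    four lengths bounds it; r >= 0 covers the case where that interval is empty. *)
Lemma measure_itvI_le (a b c d r : R) : 0 <= r ->
  (b - a <= r) \/ (b - c <= r) \/ (d - a <= r) \/ (d - c <= r) ->
  (lam (`[a, b] `&` `[c, d]) <= r%:E)%E.
Proof.
move=> r0 H.
have mitv (x y : R) : measurable (`[x, y] : set L).
  exact: measurable_lebesgue_type.
have le x y : y - x <= r -> `[a, b] `&` `[c, d] `<=` `[x, y] ->
    (lam (`[a, b] `&` `[c, d]) <= r%:E)%E.
  move=> yx sub; apply: (@le_trans _ _ (lam `[x, y])).
    by apply: le_measure => //; rewrite inE//; exact: measurableI.
  have [xy|xy] := leP x y; first by rewrite completed_lebesgue_measure_itv.
  by rewrite set_itv_ge ?bnd_simp -?ltNge// measure0.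
by case: H => [H|[H|[H|H]]]; apply: (le _ _ H) => x /=; rewrite !in_itv/=;
  move=> [/andP[? ?] /andP[? ?]]; apply/andP.
Qed.

Lemma overlap_integral_le (t : R) :
  (\int[lam]_t' K t t' <= (7 / 4 * mu ^+ 2)%:E)%E.
Proof.
have mK := measurable_overlap t.
have K0 := overlap_ge0 t.
have mu_gt0 := mu0.
(* [b] and [d] are the right endpoints of the two windows. Both have length [mu], so the nonempty
   overlaps have length mu - |b - d|. *)
have Kle (r t' : R) : 0 <= r ->
    (let b := t - h + (if `[< A t >] then 0 else mu) in
     let d := t' - h + (if `[< A t' >] then 0 else mu) in
     (mu <= r) \/ (b - d + mu <= r) \/ (d - b + mu <= r)) ->
    (K t t' <= r%:E)%E.
  move=> r0 /= H; rewrite overlapE !windowE.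
  by case: ifP H => _; case: ifP => _ H; apply: measure_itvI_le => //; lra.
have K0E (t' : R) : (K t t' <= 0%:E)%E -> K t t' = 0%E.
  by move=> K_le0; apply/le_anti/andP; split.
case: (asboolP (A t)) Kle => At Kle.
  (* Left-sided window at [t]. As a function of [t'], the overlap is a tent of height and half-width
     [mu], centred at [t] if the sides agree and at t - mu otherwise. The four pieces form the upper
     envelope of both tents, which cross at t - mu/2; their areas are 1/2, 3/8, 3/8 and 1/2 times
     mu^2. *)
  apply: (@integral_le_affine4 _ _ _ (t - 2 * mu) (t - mu) (t - mu / 2) t
    (t + mu) 1 (2 * mu - t) (-1) t 1 (mu - t) (-1) (mu + t) mK K0)
    => [||||t' tt'|t' tt'|t' tt'|t' tt'|t' tt'|];
  [lra|lra|lra|lra| | | | | |by field].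
    apply: K0E; apply: Kle => //; move: tt'; rewrite negb_and -!ltNge.
    by move=> /orP[] tt'; case: ifP => _ /=; lra.
  1-4: by apply: Kle; [lra|case: ifP => _ /=; lra].
(* Right-sided window: the tent for opposite sides is now centred at t + mu, and the crossing is at
   t + mu/2. *)
apply: (@integral_le_affine4 _ _ _ (t - mu) t (t + mu / 2) (t + mu)
  (t + 2 * mu) 1 (mu - t) (-1) (mu + t) 1 (- t) (-1) (2 * mu + t) mK K0)
  => [||||t' tt'|t' tt'|t' tt'|t' tt'|t' tt'|];
  [lra|lra|lra|lra| | | | | |by field].
  apply: K0E; apply: Kle => //; move: tt'; rewrite negb_and -!ltNge.
  by move=> /orP[] tt'; case: ifP => _ /=; lra.
all: by apply: Kle; [lra|case: ifP => _ /=; lra].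
Qed.

End Window.

(** * The L2 bound with constant 7/4 mu^2 *)

Section WindowL2.
Variable R : realType.
Local Notation L := (lebesgue_type R).
Local Notation lam := (@completed_lebesgue_measure R).
Variables (h mu : R) (A : set L).
Hypotheses (mu0 : 0 < mu) (mA : measurable A).
Variable (f : L -> \bar R).
Hypotheses (mf : measurable_fun setT f) (f0 : forall x, (0 <= f x)%E).

Local Notation k := (window_kernel h mu A).
Local Notation G := (fun t => \int[lam]_s (k (t, s) * f s))%E.

Lemma measure_window t : lam (window h mu A t) = mu%:E.
Proof.
have mu_gt0 := mu0.
by rewrite windowE; case: ifP => _; rewrite completed_lebesgue_measure_itv;
  try (congr (_%:E)); lra.
Qed.

(** A window containing [s] belongs to a time [t] within [mu] of s + h. Since the side varies with
    [t], both halves of that interval of length 2 mu must be allowed. *)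
Lemma integral_window_kernel_le s : (\int[lam]_t k (t, s) <= (2 * mu)%:E)%E.
Proof.
have mu_gt0 := mu0.
have mI : measurable (`[(s : R) + h - mu, (s : R) + h + mu]%classic : set L).
  exact: measurable_lebesgue_type.
apply: (@le_trans _ _
  (\int[lam]_t (\1_(`[(s : R) + h - mu, (s : R) + h + mu]%classic : set L) t)%:E)%E).
  apply: ge0_le_integralT.
  - apply: (measurableT_comp (measurable_window_kernel h mu mA)).
    exact: measurable_pair2.
  - by apply/measurable_EFinP/measurable_indic.
  - by move=> t; exact: window_kernel_ge0.
  - move=> t; rewrite /window_kernel lee_fin !indicE /=.
    case: (boolP (s \in window h mu A t)) => //; rewrite inE => st.
    by rewrite mem_set//= in_itv/=; case: st => -[_]; lra.
rewrite integral_indic// setIT.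
apply: (@le_trans _ _ (lam `[(s : R) + h - mu, (s : R) + h + mu])).
  exact: lexx.
by rewrite completed_lebesgue_measure_itv; [rewrite lee_fin|]; lra.
Qed.

(* Needed only to know that the left-hand side is finite, as [Schur_TTstar]
   requires. *)
Lemma window_sqr_rough_le : (\int[lam]_t (G t * G t) <=
  mu%:E * ((2 * mu)%:E * \int[lam]_s (f s * f s)))%E.
Proof.
have mu_gt0 := mu0.
have mk := measurable_window_kernel h mu mA.
have mff : measurable_fun setT (fun x => f x * f x)%E by exact: emeasurable_funM.
have mkff : measurable_fun setT (fun z : L * L => k z * (f z.2 * f z.2))%E.
  by apply: emeasurable_funM => //; exact: (measurableT_comp mff).
have kff0 z : (0 <= k z * (f z.2 * f z.2))%E.
  by rewrite !mule_ge0// window_kernel_ge0.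
have mG : measurable_fun setT G.
  apply: (@measurable_fun_fubini_tonelli_F _ _ L L R lam
    (fun z => k z * f z.2)%E).
  - by apply: emeasurable_funM => //; exact: (measurableT_comp mf).
  - by move=> z; rewrite mule_ge0// window_kernel_ge0.
have mF : measurable_fun setT (fun t => \int[lam]_s (k (t, s) * (f s * f s)))%E.
  exact: (measurable_fun_fubini_tonelli_F _ mkff kff0).
(* Cauchy-Schwarz on each window gives the factor [mu]; after Tonelli, the integral of the kernel in
   [t] gives 2 mu. *)
apply: (@le_trans _ _
  (\int[lam]_t (mu%:E * \int[lam]_s (k (t, s) * (f s * f s))))%E).
  apply: ge0_le_integralT.
  - exact: emeasurable_funM.
  - exact: measurable_funeM.
  - by move=> t; rewrite mule_ge0//; apply: integral_ge0 => s _;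
      rewrite mule_ge0// window_kernel_ge0.
  - move=> t; rewrite !integral_window_kernel.
    have mut : (lam (window h mu A t) <= mu%:E)%E by rewrite measure_window.
    exact: (sqr_integral_le (measurable_window h mu A t) mf f0 mu0 mut).
rewrite ge0_integralZl; [|exact: measurableT|exact: mF| |]; last 2 first.
- by move=> t _; apply: integral_ge0 => s _; exact: (kff0 (t, s)).
- by rewrite lee_fin ltW.
apply: lee_wpmul2l; first by rewrite lee_fin ltW.
rewrite (@fubini_tonelli _ _ _ _ _ lam lam _ mkff kff0).
rewrite -ge0_integralZl; [|exact: measurableT|exact: mff| |]; last 2 first.
- by move=> s _; rewrite mule_ge0.
- by rewrite lee_fin; lra.
apply: ge0_le_integralT.
- exact: (measurable_fun_fubini_tonelli_G _ mkff kff0).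
- exact: measurable_funeM.
- by move=> s; apply: integral_ge0 => t _; exact: (kff0 (t, s)).
- move=> s /=; rewrite ge0_integralZr.
  + apply: lee_wpmul2r; [by rewrite mule_ge0|exact: integral_window_kernel_le].
  + exact: measurableT.
  + by apply: (measurableT_comp mk); exact: measurable_pair2.
  + by move=> t _; exact: window_kernel_ge0.
  + by rewrite mule_ge0.
Qed.

Lemma window_L2_le : (\int[lam]_s (f s * f s) < +oo)%E ->
  (\int[lam]_t ((\int[lam]_(s in window h mu A t) f s) *
                (\int[lam]_(s in window h mu A t) f s)) <=
   (7 / 4 * mu ^+ 2)%:E * \int[lam]_s (f s * f s))%E.
Proof.
move=> foo.
have GG_lty : (\int[lam]_t (G t * G t) < +oo)%E.
  apply: (le_lt_trans window_sqr_rough_le).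
  have mu_gt0 := mu0.
  rewrite lte_mul_pinfty ?lee_fin ?ltW//.
  by rewrite lte_mul_pinfty ?lee_fin ?mulr_ge0 ?ltW.
have C0 : 0 < 7 / 4 * mu ^+ 2 by rewrite mulr_gt0// exprn_gt0.
have := Schur_TTstar (measurable_window_kernel h mu mA)
  (@window_kernel_ge0 _ h mu A) mf f0 C0 (overlap_integral_le h mu0 mA) GG_lty.
by under [X in (X <= _)%E -> _]eq_integral do rewrite integral_window_kernel.
Qed.

End WindowL2.

(** * The delayed integral *)

Section MovingIntegral.
Variable R : realType.
Local Notation L := (lebesgue_type R).
Local Notation lam := (@completed_lebesgue_measure R).

(** The region between the moving endpoints is measurable in the product, so the integral is a
    partial integral of a nonnegative function of (t, s), measurable by Tonelli. *)
Lemma ge0_measurable_moving_integral (a b : L -> R) (f : L -> \bar R) :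
  measurable_fun setT a -> measurable_fun setT b -> measurable_fun setT f ->
  (forall x, 0 <= f x)%E ->
  measurable_fun setT
    (fun t => \int[lam]_(s in (`[a t, b t]%classic : set L)) f s)%E.
Proof.
move=> ma mb mf f0.
pose S : set (L * L) := [set z | a z.1 <= (z.2 : R) <= b z.1].
have m2 : measurable_fun setT (fun z : L * L => z.2 : R).
  exact: (measurableT_comp (@measurable_lebesgue_typeR R) measurable_snd).
have mS : measurable S.
  rewrite (_ : S = [set z : L * L | a z.1 <= (z.2 : R)] `&`
                   [set z : L * L | (z.2 : R) <= b z.1]); last first.
    by apply/seteqP; split=> z /=; [move=> /andP|move=> [zl zr]; apply/andP].
  apply: measurableI; rewrite -[X in measurable X]setTI;
    apply: measurable_fun_le => //; exact: measurableT_comp.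
have mg : measurable_fun setT (fun z : L * L => (\1_S z)%:E * f z.2)%E.
  apply: emeasurable_funM; last exact: (measurableT_comp mf).
  by apply/measurable_EFinP/measurable_indic.
have g0 (z : L * L) : (0 <= (\1_S z)%:E * f z.2)%E by rewrite mule_ge0.
rewrite (_ : (fun t => _) = fubini_F lam (fun z => (\1_S z)%:E * f z.2)%E).
  exact: (measurable_fun_fubini_tonelli_F _ mg g0).
apply/funext => t; rewrite /fubini_F/= integral_mkcond.
apply: eq_integral => s _; rewrite /patch indicE.
rewrite (_ : ((t, s) \in S) = (s \in `[a t, b t]%classic)); last first.
  by apply/idP/idP => /set_mem H; apply/mem_set; move: H; rewrite /S/= in_itv.
by case: ifP => _; rewrite ?mul1e ?mul0e.
Qed.

Lemma measurable_moving_integral (a b g : L -> R) :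
  measurable_fun setT a -> measurable_fun setT b -> measurable_fun setT g ->
  measurable_fun setT
    (fun t => \int[lam]_(s in (`[a t, b t]%classic : set L)) g s).
Proof.
move=> ma mb mg.
have mG : measurable_fun setT (EFin \o g) by exact/measurable_EFinP.
have mfine : measurable_fun [set: \bar R] (fine : \bar R -> R).
  exact: fine_measurable.
have mp := ge0_measurable_moving_integral ma mb (measurable_funepos mG)
  (funepos_ge0 _).
have mn := ge0_measurable_moving_integral ma mb (measurable_funeneg mG)
  (funeneg_ge0 _).
have := measurableT_comp mfine (emeasurable_funB mp mn).
congr (measurable_fun _ _); apply/funext => t.
by rewrite /Rintegral integralE.
Qed.

Lemma Rintegral_shift (t a b : R) (g : L -> R) :
  measurable_fun setT g ->
  \int[lam]_(s in (`[a, b]%classic : set L)) g ((t + s)%R : R) =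
  \int[lam]_(s in (`[t + a, t + b]%classic : set L)) g s.
Proof.
move=> mg; rewrite /Rintegral.
rewrite (@integral_shift R t (`[t + a, t + b]%classic : set L) (EFin \o g)).
- congr (fine (integral _ _ _)); apply/seteqP; split => s /=;
    by rewrite !in_itv/= !lerD2l.
- exact: measurable_lebesgue_type.
- by apply: measurable_funTS; exact/measurable_EFinP.
Qed.

Lemma normr_Rintegral_le (D W : set L) (g : L -> R) :
  measurable D -> measurable W -> measurable_fun setT g -> D `<=` W ->
  (`|\int[lam]_(s in D) g s|%:E <= \int[lam]_(s in W) `|g s|%:E)%E.
Proof.
move=> mD mW mg DW.
have mG : measurable_fun setT (EFin \o g) by exact/measurable_EFinP.
(* [fine] sends infinite values to 0, so the bound holds without assuming [g] integrable on [D]. *)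
have fineE (x : \bar R) : (`|fine x|%:E <= `|x|)%E.
  by case: x => [r| |] //=; rewrite normr0 leey.
apply: (le_trans (fineE _)).
apply: (le_trans (le_abse_integral lam mD _)).
  exact: measurable_funTS.
apply: ge0_subset_integral; [exact: mD|exact: mW| |by []|exact: DW].
by apply: measurable_funTS; apply: measurableT_comp.
Qed.

End MovingIntegral.

(** * One real coordinate of the delayed integral *)

Section DelayedComponent.
Variable R : realType.
Local Notation L := (lebesgue_type R).
Local Notation lam := (@completed_lebesgue_measure R).
Local Notation D := (`[0%R, +oo[%classic : set L).
Variables (h mu : R) (eta g : R -> R).
Hypothesis (mu0 : 0 < mu).
Hypothesis eta_meas : leb_measurable `[0, +oo[ eta.
Hypothesis eta_le : forall t : R, 0 <= t -> `|eta t| <= mu.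
Hypothesis g_meas : leb_measurable `[0, +oo[ g.

Let g0 (s : R) : R := if s <= 0 then 0 else g s.

Definition delayed_integral (t : R) : R :=
  if - h - eta t <= - h then \int[lam]_(s in `[- h - eta t, - h]) g0 (t + s)
  else - \int[lam]_(s in `[- h, - h - eta t]) g0 (t + s).

Let mD : measurable D. Proof. exact: measurable_lebesgue_type. Qed.

Let mg0 : measurable_fun [set: L] (g0 : L -> R).
Proof.
rewrite (_ : (g0 : L -> R) = (g : L -> R) \_ (`]0%R, +oo[%classic : set L)).
  apply/(measurable_restrictT _ _).1; first exact: measurable_lebesgue_type.
  apply: measurable_funS g_meas => // s /=; rewrite !in_itv/= !andbT.
  exact: ltW.
apply/funext => s; rewrite /g0 /patch; case: leP => s0.
  by rewrite memNset//= in_itv/= andbT ltNge s0.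
by rewrite mem_set//= in_itv/= andbT.
Qed.

(** [eta] is controlled on [0, oo) only; extending it by 0 gives a function measurable on the whole
    line. *)
Let eta0 : L -> R := (eta : L -> R) \_ D.

Let meta0 : measurable_fun [set: L] eta0.
Proof. exact/(measurable_restrictT _ _).1. Qed.

Let eta0E (t : R) : 0 <= t -> eta0 t = eta t.
Proof. by move=> t0; rewrite /eta0 /patch mem_set//= in_itv/= t0. Qed.

Let mid : measurable_fun [set: L] (fun t : L => t : R).
Proof. exact: measurable_lebesgue_typeR. Qed.

Let delayed_integralE (t : R) : 0 <= t -> delayed_integral t =
  if 0 <= eta0 t then \int[lam]_(s in `[t - h - eta0 t, t - h]) g0 s
  else - \int[lam]_(s in `[t - h, t - h - eta0 t]) g0 s.
Proof.
move=> t0; rewrite /delayed_integral eta0E//.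
rewrite lerBlDr lerDl; case: ifP => _; rewrite (Rintegral_shift _ _ _ mg0);
  by rewrite !addrA.
Qed.

Lemma measurable_delayed_integral : leb_measurable `[0, +oo[ delayed_integral.
Proof.
pose v (t : L) := if 0 <= eta0 t
  then \int[lam]_(s in `[(t : R) - h - eta0 t, (t : R) - h]) g0 s
  else - \int[lam]_(s in `[(t : R) - h, (t : R) - h - eta0 t]) g0 s.
have mth : measurable_fun [set: L] (fun t : L => (t : R) - h).
  exact: measurable_funB.
have mthe : measurable_fun [set: L] (fun t : L => (t : R) - h - eta0 t).
  exact: measurable_funB.
have mv : measurable_fun [set: L] v.
  apply: measurable_fun_ifT.
  - exact: measurable_fun_ler.
  - exact: (measurable_moving_integral mthe mth mg0).
  - apply: measurable_funN.
    exact: (measurable_moving_integral mth mthe mg0).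
apply: (@eq_measurable_fun _ _ L R D v); last exact: measurable_funTS.
by move=> t; rewrite inE/= in_itv/= andbT => t0; rewrite delayed_integralE.
Qed.

Let A : set L := [set t | (0 <= (t : R)) /\ 0 <= eta0 t].

Let mA : measurable A.
Proof.
rewrite (_ : A = [set t : L | 0 <= (t : R)] `&` [set t : L | 0 <= eta0 t])//.
by apply: measurableI; rewrite -[X in measurable X]setTI;
  apply: measurable_fun_le.
Qed.

(** The interval of integration has t - h as an endpoint, has length |eta t| <= mu and lies on the
    side recorded by [A]. For the absolute value it may be enlarged to the full window. *)
Let delayed_integral_le (t : R) : 0 <= t ->
  (`|delayed_integral t|%:E <=
   \int[lam]_(s in window h mu A t) `|g0 s|%:E)%E.
Proof.
move=> t0; rewrite delayed_integralE//; have := eta_le t0.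
have mW := @measurable_window R h mu A t.
rewrite -(eta0E t0) ler_norml => /andP[le1 le2].
case: ifP => et; rewrite ?normrN; apply: normr_Rintegral_le => //;
  try exact: measurable_lebesgue_type; move=> s /=; rewrite in_itv/= => /andP[s1 s2].
- by left; split; [split|]; lra.
- right; split; first by move=> []; rewrite et.
  by move/negbT: et; rewrite -ltNge => et; lra.
Qed.

Lemma delayed_integral_L2 :
  (\int[lam]_(t in D) (g t ^+ 2)%:E < +oo)%E ->
  (\int[lam]_(t in D) (delayed_integral t ^+ 2)%:E <=
   (7 / 4 * mu ^+ 2)%:E * \int[lam]_(t in D) (g t ^+ 2)%:E)%E.
Proof.
move=> goo.
pose f (s : L) := `|g0 s|%:E : \bar R.
have mf : measurable_fun [set: L] f.
  by apply/measurable_EFinP; exact: measurableT_comp.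
have f0 s : (0 <= f s)%E by rewrite lee_fin.
have mgg : measurable_fun D (fun t => (g t ^+ 2)%:E).
  by apply/measurable_EFinP; exact: measurable_funX.
(* [f] vanishes at s <= 0 and equals |g| beyond, so passing to the whole line adds nothing. *)
have ffle : (\int[lam]_s (f s * f s) <= \int[lam]_(t in D) (g t ^+ 2)%:E)%E.
  rewrite [X in (_ <= X)%E]integral_mkcond.
  apply: ge0_le_integralT.
  - exact: emeasurable_funM.
  - exact/(measurable_restrictT _ _).1.
  - by move=> s; rewrite mule_ge0.
  - move=> s; rewrite /f -EFinM -expr2 real_normK ?num_real// /g0.
    case: (leP (s : R) 0) => s0.
      rewrite expr0n; apply: erestrict_ge0 => x _.
      by rewrite lee_fin sqr_ge0.
    by rewrite /patch mem_set//= in_itv/= ltW.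
have foo := le_lt_trans ffle goo.
have C0 : (0 <= (7 / 4 * mu ^+ 2)%:E :> \bar R)%E.
  by rewrite lee_fin mulr_ge0// sqr_ge0.
apply: le_trans (lee_wpmul2l C0 ffle).
apply: le_trans (window_L2_le h mu0 mA mf f0 foo).
rewrite integral_mkcond.
have mv := measurable_delayed_integral.
have mG : measurable_fun [set: L]
    (fun t => \int[lam]_(s in window h mu A t) f s)%E.
  under eq_fun do rewrite -integral_window_kernel.
  apply: (@measurable_fun_fubini_tonelli_F _ _ L L R lam
    (fun z => window_kernel h mu A z * f z.2)%E).
  - apply: emeasurable_funM; first exact: measurable_window_kernel.
    exact: (measurableT_comp mf).
  - by move=> z; rewrite mule_ge0// window_kernel_ge0.
apply: ge0_le_integralT.
- apply/(measurable_restrictT _ mD).1.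
  by apply/measurable_EFinP; exact: measurable_funX.
- exact: emeasurable_funM.
- by move=> t; apply: erestrict_ge0 => s _; rewrite lee_fin sqr_ge0.
- have G0 t : (0 <= \int[lam]_(s in window h mu A t) f s)%E.
    exact: integral_ge0.
  move=> t; rewrite /patch; case: ifPn => tD; last exact: mule_ge0.
  have t0 : 0 <= (t : R) by move: tD; rewrite inE/= in_itv/= andbT.
  rewrite -(real_normK (num_real _)) expr2 EFinM.
  by apply: lee_pmul; rewrite ?lee_fin//; exact: delayed_integral_le.
Qed.

End DelayedComponent.

(** * Decomposition into 2n real coordinates *)

Section Components.
Variables (R : realType) (n : nat).
Local Notation L := (lebesgue_type R).
Local Notation lam := (@completed_lebesgue_measure R).
Local Notation D := (`[0%R, +oo[%classic : set L).

Lemma enorm_sqr (v : 'cV[R[i]]_n) :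
  enorm v ^+ 2 = \sum_(i < n) (complex.Re (v i ord0) ^+ 2 +
                              complex.Im (v i ord0) ^+ 2).
Proof.
rewrite /enorm sqr_sqrtr; last by apply: sumr_ge0 => i _; exact: sqr_ge0.
apply: eq_bigr => i _; case: (v i ord0) => a b /=.
by rewrite sqr_sqrtr// addr_ge0// sqr_ge0.
Qed.

Lemma integral_enorm_sqr (v : R -> 'cV[R[i]]_n) :
  (forall i, leb_measurable `[0, +oo[ (fun t => complex.Re (v t i ord0)) /\
             leb_measurable `[0, +oo[ (fun t => complex.Im (v t i ord0))) ->
  (\int[lam]_(t in D) (enorm (v t) ^+ 2)%:E =
   \sum_(i < n) (\int[lam]_(t in D) (complex.Re (v t i ord0) ^+ 2)%:E +
                 \int[lam]_(t in D) (complex.Im (v t i ord0) ^+ 2)%:E))%E.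
Proof.
move=> mv.
have mD : measurable D by exact: measurable_lebesgue_type.
have mRe i : measurable_fun D (fun t => (complex.Re (v t i ord0) ^+ 2)%:E).
  by apply/measurable_EFinP; apply: measurable_funX; exact: (mv i).1.
have mIm i : measurable_fun D (fun t => (complex.Im (v t i ord0) ^+ 2)%:E).
  by apply/measurable_EFinP; apply: measurable_funX; exact: (mv i).2.
under eq_integral do rewrite enorm_sqr -sumEFin.
rewrite ge0_integral_sum; [|exact: mD| |]; last 2 first.
- by move=> i; apply/measurable_EFinP; apply: measurable_funD;
    apply: measurable_funX; [exact: (mv i).1|exact: (mv i).2].
- by move=> i t _; rewrite lee_fin addr_ge0// sqr_ge0.
apply: eq_bigr => i _; under eq_integral do rewrite EFinD.
rewrite ge0_integralD//.
- by move=> t _; rewrite lee_fin sqr_ge0.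
- by move=> t _; rewrite lee_fin sqr_ge0.
Qed.

Lemma Re_oriented_integral (h t : R) (eta : R -> R) (y : R -> 'cV[R[i]]_n) i :
  complex.Re (oriented_integral (- h - eta t) (- h)
    (fun s => zero_ext y (t + s)) i ord0) =
  delayed_integral h eta (fun s => complex.Re (y s i ord0)) t.
Proof.
rewrite /oriented_integral /delayed_integral.
have E s : complex.Re (zero_ext y s i ord0) =
    if s <= 0 then 0 else complex.Re (y s i ord0).
  by rewrite /zero_ext; case: ifP; rewrite ?mxE.
by case: ifP => _; rewrite !mxE /=; under eq_Rintegral do rewrite E.
Qed.

Lemma Im_oriented_integral (h t : R) (eta : R -> R) (y : R -> 'cV[R[i]]_n) i :
  complex.Im (oriented_integral (- h - eta t) (- h)
    (fun s => zero_ext y (t + s)) i ord0) =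
  delayed_integral h eta (fun s => complex.Im (y s i ord0)) t.
Proof.
rewrite /oriented_integral /delayed_integral.
have E s : complex.Im (zero_ext y s i ord0) =
    if s <= 0 then 0 else complex.Im (y s i ord0).
  by rewrite /zero_ext; case: ifP; rewrite ?mxE.
by case: ifP => _; rewrite !mxE /=; under eq_Rintegral do rewrite E.
Qed.

End Components.

(** * Normalisation and the vector-valued estimate *)

Lemma scaled_delayed_integral_L2 (R : realType) (h mu c : R) (eta g w : R -> R) :
  0 < mu -> leb_measurable `[0, +oo[ eta ->
  (forall t, 0 <= t -> `|eta t| <= mu) -> leb_measurable `[0, +oo[ g ->
  (\int[@completed_lebesgue_measure R]_(t in `[0%R, +oo[) (g t ^+ 2)%:E < +oo)%E ->
  c ^+ 2 * (7 / 4 * mu ^+ 2) = 1 ->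
  (forall t, 0 <= t -> w t = c * delayed_integral h eta g t) ->
  leb_measurable `[0, +oo[ w /\
  (\int[@completed_lebesgue_measure R]_(t in `[0%R, +oo[) (w t ^+ 2)%:E <=
   \int[@completed_lebesgue_measure R]_(t in `[0%R, +oo[) (g t ^+ 2)%:E)%E.
Proof.
move=> mu0 meta eta_le mg goo c2 wE.
have mD : measurable (`[0%R, +oo[%classic : set (lebesgue_type R)).
  exact: measurable_lebesgue_type.
have mv := measurable_delayed_integral h meta mg.
split.
  apply: (@eq_measurable_fun _ _ (lebesgue_type R) R _
    (fun t => c * delayed_integral h eta g t)).
    by move=> t; rewrite inE/= in_itv/= andbT => t0; rewrite wE.
  by apply: measurable_funM => //; exact: mv.
have c20 : (0 <= (c ^+ 2)%:E)%E by rewrite lee_fin sqr_ge0.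
(* The normalisation of [c] cancels the constant 7/4 mu^2 exactly, leaving gain at most 1. *)
have := lee_wpmul2l c20 (delayed_integral_L2 h mu0 meta eta_le mg goo).
rewrite muleA -EFinM c2 mul1e; apply: le_trans.
rewrite -ge0_integralZl; [|exact: mD| | |exact: c20]; last 2 first.
- by apply/measurable_EFinP; apply: measurable_funX; exact: mv.
- by move=> t _; rewrite lee_fin sqr_ge0.
rewrite le_eqVlt; apply/orP; left; apply/eqP.
apply: eq_integral => t; rewrite inE/= in_itv/= andbT => t0.
by rewrite wE// exprMn EFinM.
Qed.

Theorem lemma2 (R : realType) (n : nat) (h mu : R) (tau eta : R -> R)
  (hn : (1 <= n)%N) (hmu : 0 < mu) (hh : mu <= h)
  (htau : forall t : R, 0 <= t -> tau t = h + eta t)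
  (eta_meas : leb_measurable `[0, +oo[ eta)
  (eta_le : forall t : R, 0 <= t -> `|eta t| <= mu)
  (y : R -> 'cV[R[i]]_n) (yL2 : L2 y)
  (u : R -> 'cV[R[i]]_n)
  (u_def : forall t : R, 0 <= t ->
     u t = (- (1 / (mu * Num.sqrt (Finfty R))))%:C *:
           oriented_integral (- h - eta t) (- h)
             (fun s : R => zero_ext y (t + s))) :
  L2 u /\ L2norm u ^+ 2 <= L2norm y ^+ 2.
Proof.
case: yL2 => my yoo.
set c := - (1 / (mu * Num.sqrt (Finfty R))) in u_def.
have c2 : c ^+ 2 * (7 / 4 * mu ^+ 2) = 1.
  have F0 : Num.sqrt (Finfty R) != 0 by rewrite gt_eqF// sqrtr_gt0 divr_gt0.
  have F2 : Num.sqrt (Finfty R) ^+ 2 = 7 / 4.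
    by rewrite sqr_sqrtr// divr_ge0.
  by rewrite -F2 /c; field; rewrite F0 gt_eqF.
have uRe i t : 0 <= t -> complex.Re (u t i ord0) =
    c * delayed_integral h eta (fun s => complex.Re (y s i ord0)) t.
  move=> t0; rewrite u_def// mxE -Re_oriented_integral.
  by case: (oriented_integral _ _ _ i ord0) => a b /=; rewrite mul0r subr0.
have uIm i t : 0 <= t -> complex.Im (u t i ord0) =
    c * delayed_integral h eta (fun s => complex.Im (y s i ord0)) t.
  move=> t0; rewrite u_def// mxE -Im_oriented_integral.
  by case: (oriented_integral _ _ _ i ord0) => a b /=; rewrite mul0r addr0.
have sum_lty := yoo; rewrite integral_enorm_sqr// in sum_lty.
have int0 (g : R -> R) : (0 <=
    \int[@completed_lebesgue_measure R]_(t in `[0%R, +oo[) (g t ^+ 2)%:E)%E.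
  by apply: integral_ge0 => t _; rewrite lee_fin sqr_ge0.
(* Each coordinate integral is one term of a finite sum of nonnegative terms whose total is
   finite. *)
have ylty i :
    (\int[@completed_lebesgue_measure R]_(t in `[0%R, +oo[)
       (complex.Re (y t i ord0) ^+ 2)%:E < +oo)%E /\
    (\int[@completed_lebesgue_measure R]_(t in `[0%R, +oo[)
       (complex.Im (y t i ord0) ^+ 2)%:E < +oo)%E.
  rewrite (bigD1 i)//= in sum_lty; split; apply: le_lt_trans sum_lty.
    rewrite -addeA leeDl// adde_ge0//; apply: sume_ge0 => j _; exact: adde_ge0.
  rewrite addeAC leeDr// adde_ge0//; apply: sume_ge0 => j _; exact: adde_ge0.
have HRe i := scaled_delayed_integral_L2 hmu eta_meas eta_le (my i).1 (ylty i).1 c2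
  (uRe i).
have HIm i := scaled_delayed_integral_L2 hmu eta_meas eta_le (my i).2 (ylty i).2 c2
  (uIm i).
have mu_ i := conj (HRe i).1 (HIm i).1.
(* The comparison is made in the extended reals first, so that it also yields the finiteness
   required for [L2 u]. *)
have le_int : (\int[@completed_lebesgue_measure R]_(t in `[0%R, +oo[)
     (enorm (u t) ^+ 2)%:E <=
   \int[@completed_lebesgue_measure R]_(t in `[0%R, +oo[)
     (enorm (y t) ^+ 2)%:E)%E.
  rewrite (integral_enorm_sqr mu_) (integral_enorm_sqr my).
  by apply: lee_sum => i _; apply: leeD; [exact: (HRe i).2|exact: (HIm i).2].
have ulty := le_lt_trans le_int yoo.
split; first by split.
have Rint0 (v : R -> 'cV[R[i]]_n) :
    0 <= \int[@completed_lebesgue_measure R]_(t in `[0, +oo[) enorm (v t) ^+ 2.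
  by apply: fine_ge0; exact: int0.
(* Both integrals are finite, so [fine] preserves the inequality between them. *)
rewrite /L2norm !sqr_sqrtr//; apply: fine_le => //.
  by rewrite ge0_fin_numE//; exact: int0.
by rewrite ge0_fin_numE//; exact: int0.
Qed.
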